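(* Let $K$ be a Polish space and let $f:K\to\mathbb{R}$ be a function. Then the following are equivalent: (1) $f\in \mathrm{DSC}(K)$. (2) For any closed non-empty subset $L$ of $K$, $f|_L$ has a strong continuity point. (3) For any closed non-empty subset $L$ of $K$, the set of strong continuity points of $f|_L$ contains a dense $G_\delta$ subset of $L$. (4) For any closed non-empty subset $L$ of $K$, there exists an $x\in L$ such that $\sup_\alpha \mathrm{osc}_\alpha (f|_L)(x)<\infty$.
   Context: $C(K)$ is the class of continuous functions $K\to\mathbb{R}$. $\mathrm{DSC}(K)$ is the set of $f:K\to\mathbb{R}$ for which there is a sequence $(f_n)\subset C(K)$ with $f_n\to f$ pointwise and $\sum_{n=1}^\infty|f_{n+1}(k)-f_n(k)|<\infty$ for every $k\in K$ (equivalently, the differences of two real-valued semi-continuous functions on $K$). Transfinite oscillations: let $X$ be a Polish space (e.g. a closed subset $L$ of $K$ with the relative topology). For $g:X\to[-\infty,\infty]$ and $x\in X$, $\limsup_{y\to x}g(y)$ denotes the unrestricted limsup $\inf_U\sup g(U)$, the infimum over all open neighborhoods $U$ of $x$ in $X$ (so $y=x$ is allowed), and the upper semi-continuous envelope of $g$ is $\mathbf{U}g(x)=\limsup_{y\to x}g(y)$. For $h:X\to\mathbb{R}$ define $\mathrm{osc}_\alpha h:X\to[0,\infty]$ for ordinals $\alpha<\omega_1$ by induction: $\mathrm{osc}_0h\equiv0$; if $\beta=\alpha+1$, put $\widetilde{\mathrm{osc}}_\beta h(x)=\limsup_{y\to x}\big(|h(y)-h(x)|+\mathrm{osc}_\alpha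 h(y)\big)$ for all $x\in X$; if $\beta$ is a limit ordinal, put $\widetilde{\mathrm{osc}}_\beta h=\sup_{\alpha<\beta}\mathrm{osc}_\alpha h$; in both cases $\mathrm{osc}_\beta h=\mathbf{U}\,\widetilde{\mathrm{osc}}_\beta h$. For $f|_L$ all these are computed in the space $L$. A point $x\in X$ is a strong continuity point of $h$ if $\mathrm{osc}_\alpha h(x)=0$ for all (countable ordinals) $\alpha$; $\sup_\alpha$ is likewise over all countable ordinals. *)

(* Defs.v *)
From HB Require Import structures.
From mathcomp Require Import all_boot all_order all_algebra.
From mathcomp Require Import all_classical wochoice all_reals all_analysis.

Set Implicit Arguments.
Unset Strict Implicit.
Unset Printing Implicit Defensive.

Import Order.TTheory GRing.Theory Num.Theory.
Import numFieldNormedType.Exports.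

Local Open Scope classical_set_scope.
Local Open Scope ring_scope.

(* The ordinal omega_1, as the set of those elements of a well-ordered
   uncountable set (here the power set of nat) that have only countably many
   predecessors.  [omega1_segment_countable] and [omega1_uncountable] below,
   with [lt_omega1_wf], characterize its order type; so the elements of
   [omega1] stand for the countable ordinals. *)

Definition wo_setN : rel (set nat) :=
  projT1 (well_ordering_principle (set nat)).

Lemma wo_setNP : well_order wo_setN.
Proof. exact: projT2 (well_ordering_principle (set nat)). Qed.

Lemma wo_setN_chain : wo_chain wo_setN predT.
Proof. by move=> A _; exact: wo_setNP. Qed.

Lemma wo_setN_total : total wo_setN.
Proof. by move=> x y; exact: (wo_chainW wo_setN_chain). Qed.

Lemma wo_setN_anti : antisymmetric wo_setN.
Proof. by move=> x y; exact: (wo_chain_antisymmetric wo_setN_chain). Qed.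

Lemma wo_setN_refl : reflexive wo_setN.
Proof. by move=> x; exact: (wo_chain_reflexive wo_setN_chain). Qed.

Lemma wo_setN_trans : transitive wo_setN.
Proof.
move=> y x z xy yz.
have [|m [[mA mlb] _]] := wo_setNP (A := mem [:: x; y; z]).
  by exists x; rewrite inE eqxx.
have [mx my mz] : [/\ wo_setN m x, wo_setN m y & wo_setN m z].
  by split; apply: mlb; rewrite !inE eqxx ?orbT.
move: mA; rewrite !inE => /or3P[] /eqP E; subst m => //.
- have -> // : x = y by apply: wo_setN_anti; rewrite xy.
- have yz' : y = z by apply: wo_setN_anti; rewrite yz.
  by rewrite -yz'.
Qed.

Definition omega1 : Type :=
  {x : set nat | `[< countable [set y | wo_setN y x] >]}.

HB.instance Definition _ := Choice.on omega1.

Definition omega1_le (a b : omega1) := wo_setN (val a) (val b).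

Lemma omega1_le_refl : reflexive omega1_le.
Proof. by move=> a; exact: wo_setN_refl. Qed.

Lemma omega1_le_anti : antisymmetric omega1_le.
Proof. by move=> a b /wo_setN_anti/val_inj. Qed.

Lemma omega1_le_trans : transitive omega1_le.
Proof. by move=> b a c; exact: wo_setN_trans. Qed.

Lemma omega1_le_total : total omega1_le.
Proof. by move=> a b; exact: wo_setN_total. Qed.

HB.instance Definition _ := Order.Le_isPOrder.Build Order.default_display
  omega1 omega1_le_refl omega1_le_anti omega1_le_trans.

HB.instance Definition _ := Order.POrder_isTotal.Build Order.default_display
  omega1 omega1_le_total.

Lemma omega1_min (A : set omega1) : A !=set0 ->
  exists2 a, A a & forall b, A b -> (a <= b)%O.
Proof.
move=> [a0 Aa0].
have [|m [[/asboolP[a Aa <-] mlb] _]] :=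
    wo_setNP (A := fun x => `[< exists2 a, A a & val a = x >]).
  by exists (val a0); apply/asboolP; exists a0.
by exists a => // b Ab; apply: mlb; apply/asboolP; exists b.
Qed.

Lemma lt_omega1_wf : well_founded (fun a b : omega1 => (a < b)%O).
Proof.
move=> a; apply: contrapT => na.
have [|m nm mmin] := omega1_min (A := [set a | ~ Acc (fun a b => (a < b)%O) a]).
  by exists a.
apply: nm; constructor => b ltbm; apply: contrapT => /mmin.
by rewrite leNgt ltbm.
Qed.

Lemma omega1_segment_countable (a : omega1) : countable [set b | (b <= a)%O].
Proof.
have /asboolP := valP a; apply: sub_countable.
rewrite -(card_le_eql (inj_card_eq (in2W val_inj))).
by apply: subset_card_le => _ [b ba <-].
Qed.

Lemma omega1_uncountable : ~ countable [set: omega1].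
Proof.
rewrite -(eq_countable (inj_card_eq (in2W (@val_inj _ _ omega1)))) => cS.
have [allc|] := pselect (forall x, countable [set y | wo_setN y x]); last first.
  move=> /existsNP[x0 nx0].
  have [|m [[/asboolP nm mmin] _]] :=
      wo_setNP (A := fun x => `[< ~ countable [set y | wo_setN y x] >]).
    by exists x0; apply/asboolP.
  apply: nm.
  apply: (@sub_countable _ _ _ ((val @` [set: omega1]) `|` [set m])).
    apply: subset_card_le => y /= ym; have [->|/eqP ynem] := eqVneq y m.
      by right.
    left; have cy : `[< countable [set z | wo_setN z y] >].
      apply/asboolP; apply: contrapT => ncy; apply: ynem; apply: wo_setN_anti.
      by rewrite ym mmin //; apply/asboolP.
    by exists (exist _ y cy).
  by rewrite -bigcup2E; apply: bigcup_countable => // -[|[|n]] _ //=.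
have : countable [set: set nat].
  apply: sub_countable cS; apply: subset_card_le => x _.
  by exists (exist _ x (asboolT (allc x))).
move=> /countable_injP[g ginj].
pose D : set nat := [set n | exists2 A : set nat, g A = n & ~ A n].
have nD : ~ D (g D).
  by move=> /[dup] DgD [A /ginj]; rewrite !inE => /(_ I I) ->.
by apply: (nD); exists D.
Qed.

Section oscillation.
Context {R : realType} {X : topologicalType}.
Implicit Types (h : X -> R) (g : X -> \bar R) (a b : omega1).
Local Open Scope ereal_scope.

(* [limf_esup g (nbhs x)] is the infimum of [ereal_sup (g @` V)] over the
   neighborhoods V of x, all of which contain x. *)
Definition usc_env g : X -> \bar R := fun x => limf_esup g (nbhs x).

Definition osc_succ h g : X -> \bar R :=
  fun x => limf_esup (fun y => `|h y - h x|%:E + g y) (nbhs x).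

Definition is_succ a b := (a < b)%O /\ forall c, ~ (a < c < b)%O.

Definition is_limit b :=
  (exists a, (a < b)%O) /\ ~ (exists a, is_succ a b).

(* One step of the transfinite recursion; [F] gives the oscillations below [b],
   and the junk value of [G] outside of its domain is never used. *)
Definition osc_step h b (F : forall a, (a < b)%O -> X -> \bar R) :
    X -> \bar R :=
  let G a := if pselect (a < b)%O is left ltab then F a ltab else cst 0 in
  if pselect (exists a, is_succ a b) is left Hb then
    usc_env (osc_succ h (G (projT1 (cid Hb))))
  else if pselect (exists a, (a < b)%O) is left _ then
    usc_env (fun x => ereal_sup [set G a x | a in [set a | (a < b)%O]])
  else cst 0.

Definition osc h : omega1 -> X -> \bar R :=
  Fix lt_omega1_wf (fun=> X -> \bar R) (osc_step h).

Let osc_unfold h b : osc h b = osc_step h (fun a (_ : (a < b)%O) => osc h a).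
Proof.
rewrite /osc Fix_eq // => c F G FG; congr osc_step.
by apply: functional_extensionality_dep => a; apply: funext => ltac.
Qed.

Lemma osc_zero h b : (forall a, (b <= a)%O) -> osc h b = cst 0.
Proof.
move=> bmin; rewrite osc_unfold /osc_step.
case: pselect => [Hb|_]; first by have [a [+ _]] := Hb; rewrite ltNge bmin.
by case: pselect => [[a]|//]; rewrite ltNge bmin.
Qed.

Lemma osc_succE h a b : is_succ a b ->
  osc h b = usc_env (osc_succ h (osc h a)).
Proof.
move=> [ab sab]; rewrite osc_unfold /osc_step.
case: pselect => [Hb|[]]; last by exists a.
case: cid => c [cb scb] /=; case: pselect => // _.
suff -> : c = a by [].
case: (ltgtP c a) => // [ca|ac].
- by have := scb a; rewrite ca ab.
- by have := sab c; rewrite ac cb.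
Qed.

Lemma osc_limitE h b : is_limit b ->
  osc h b = usc_env (fun x =>
    ereal_sup [set osc h a x | a in [set a | (a < b)%O]]).
Proof.
move=> [[a0 a0b] nsb]; rewrite osc_unfold /osc_step.
case: pselect => // _; case: pselect => [_|[]]; last by exists a0.
congr usc_env; apply: funext => x; congr ereal_sup.
by apply: eq_imagel => a ab; case: pselect.
Qed.

Definition strong_continuity_point h (x : X) := forall a, osc h a x = 0.

End oscillation.

Section polish.
Context {R : realType}.

Definition is_metric {T : Type} (d : T -> T -> R) :=
  [/\ forall x y, 0 <= d x y,
      forall x y, d x y = 0 <-> x = y,
      forall x y, d x y = d y x &
      forall x y z, d x z <= d x y + d y z].

Definition metrizes {T : topologicalType} (d : T -> T -> R) :=
  forall (x : T) (U : set T),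
    nbhs x U <-> exists2 e : R, 0 < e & [set y | d x y < e] `<=` U.

Definition complete_metric {T : topologicalType} (d : T -> T -> R) :=
  forall u : nat -> T,
    (forall e : R, 0 < e -> exists N, forall m n, (N <= m)%N -> (N <= n)%N ->
      d (u m) (u n) < e) ->
    exists x : T, u n @[n --> \oo] --> x.

Definition polish_space (T : topologicalType) :=
  (exists2 D : set T, countable D & dense D) /\
  (exists d : T -> T -> R, [/\ is_metric d, metrizes d & complete_metric d]).

End polish.
Arguments polish_space R T : clear implicits.

Definition DSC {R : realType} {K : topologicalType} (f : K -> R) :=
  exists f_ : nat -> K -> R,
    [/\ forall n, continuous (f_ n),
        forall k, f_ n k @[n --> \oo] --> f k &
        forall k, (\sum_(0 <= n <oo) `|f_ n.+1 k - f_ n k|%:E < +oo)%E].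

(* Main.v *)
Require Import Defs.
From mathcomp Require Import all_boot all_order all_algebra.
From mathcomp Require Import all_classical all_reals all_analysis.
From mathcomp Require Import borel_hierarchy ring lra.

Set Implicit Arguments.
Unset Strict Implicit.
Unset Printing Implicit Defensive.

Import Order.TTheory GRing.Theory Num.Theory.
Import numFieldNormedType.Exports.

Local Open Scope classical_set_scope.
Local Open Scope ring_scope.

(** Oscillations and semicontinuous functions are linked by a domination
   principle ([osc_le]): if [g >= 0] and one oscillation step over [g] stays
   below [g] (for a real-valued [g]: if [g + h] and [g - h] are upper
   semicontinuous), then [g] bounds all the transfinite oscillations of [h].

   If [h] is the pointwise limit of continuous [f_n] with summable increments,
   then [s = \sum_n |f_(n+1) - f_n|] makes [s + h] and [s - h] lower
   semicontinuous ([DSC_lsc]).  At a continuity point [x0] of [s], the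
   function equal to [s x0 + e - s] near [x0] and to [+oo] elsewhere dominates
   the oscillations and has the value [e] at [x0], so [x0] is a strong
   continuity point ([lsc_strong_continuity]).  As [s] is lower semicontinuous,
   Baire's theorem makes its continuity points contain a dense G_delta set
   ([DSC_residual]).  This applies to the restriction of a DSC function to any
   closed subset.

   For the converse, the supremum [g] of all the oscillations is itself stable
   under an oscillation step ([osc_succ_osc_sup]), because countably many
   countable ordinals are bounded by a countable one.  So, on a closed set and
   near a point where [g] is finite, [s = C - g] for a large constant [C] makes
   [s + f] and [s - f] nonnegative and lower semicontinuous
   ([osc_sup_lsc_split]).  An exhaustion argument over a countable base covers
   the space by countably many closed sets with such an [s]
   ([lsc_split_exhaustion]), and these local functions are glued into a global
   one by adding a correction that blows up at the lower levels of the cover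
   ([lsc_split_closed_cover]).  Finally nonnegative lower semicontinuous
   functions are increasing limits of Lipschitz functions, which turns [s + f]
   and [s - f] into a sequence witnessing that [f] is DSC ([lsc_DSC]). *)

(** * Countable ordinals *)

(** Countable families of countable ordinals are strictly bounded. *)
Lemma omega1_above (u : nat -> omega1) : exists b, forall n, (u n < b)%O.
Proof.
apply: contrapT => /forallNP nb.
apply: omega1_uncountable.
apply: (@sub_countable _ _ _ (\bigcup_n [set b | (b <= u n)%O])).
  apply: subset_card_le => b _.
  have /existsNP[n /negP] := nb b; rewrite -leNgt => bn.
  by exists n.
apply: bigcup_countable => // n _; exact: omega1_segment_countable.
Qed.

Lemma omega1_succ a : exists b, is_succ a b.
Proof.
have [b0 /(_ 0%N) ab0] := omega1_above (fun=> a).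
have [|b ab bmin] := omega1_min (A := [set b | (a < b)%O]); first by exists b0.
exists b; split=> // c /andP[ac cb].
by have := bmin _ ac; rewrite leNgt cb.
Qed.

Lemma omega1_zero : exists z : omega1, forall a, (z <= a)%O.
Proof.
have [b0 _] : exists b : omega1, True.
  apply: contrapT => /forallNP n; apply: omega1_uncountable.
  suff -> : [set: omega1] = set0 by exact: countable0.
  by apply/seteqP; split => // x _; have := n x.
have [|z _ zmin] := omega1_min (A := [set: omega1]); first by exists b0.
by exists z => a; exact: zmin.
Qed.

Lemma omega1_cases (b : omega1) :
  [\/ forall a, (b <= a)%O, exists a, is_succ a b | is_limit b].
Proof.
have [?|nz] := pselect (forall a, (b <= a)%O); first exact: Or31.
have [?|ns] := pselect (exists a, is_succ a b); first exact: Or32.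
apply: Or33; split => //.
by have /existsNP[a /negP] := nz; rewrite -ltNge; exists a.
Qed.

(** * Transfinite oscillations *)

Section oscillations.
Context {R : realType} {X : topologicalType}.
Implicit Types (h s : X -> R) (g : X -> \bar R) (a b : omega1) (x : X).
Local Open Scope ereal_scope.

Lemma limf_esup_le g x c :
  (\forall y \near x, g y <= c) -> limf_esup g (nbhs x) <= c.
Proof.
move=> gc; apply: (@le_trans _ _ (ereal_sup (g @` [set y | g y <= c]))).
  by apply: ereal_inf_lbound; exists [set y | g y <= c].
by apply: ge_ereal_sup => _ [y yc <-].
Qed.

Lemma usc_env_ge g x : g x <= usc_env g x.
Proof.
apply: le_ereal_inf_tmp => _ [V /nbhs_singleton Vx <-].
by apply: ereal_sup_ubound; exists x.
Qed.

Lemma limf_esup_lt g x c :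
  limf_esup g (nbhs x) < c -> \forall y \near x, g y < c.
Proof.
move=> /ereal_inf_lt[_ [V Vx <-] Vc]; apply: filterS Vx => y Vy.
by apply: le_lt_trans Vc; apply: ereal_sup_ubound; exists y.
Qed.

Lemma le_limf_esup g g' x : (forall y, g y <= g' y) ->
  limf_esup g (nbhs x) <= limf_esup g' (nbhs x).
Proof.
move=> gg'; apply: le_ereal_inf_tmp => _ [V Vx <-].
apply: (@le_trans _ _ (ereal_sup (g @` V))).
  by apply: ereal_inf_lbound; exists V.
apply: ge_ereal_sup => _ [y Vy <-]; apply: le_trans (gg' y) _.
by apply: ereal_sup_ubound; exists y.
Qed.

Lemma le_osc_succ h g g' x : (forall y, g y <= g' y) ->
  osc_succ h g x <= osc_succ h g' x.
Proof. by move=> gg'; apply: le_limf_esup => y; exact: leeD. Qed.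

Lemma usc_env_le_osc_succ h g x : usc_env g x <= osc_succ h g x.
Proof. by apply: le_limf_esup => y; rewrite leeDr// lee_fin. Qed.

Lemma le_osc_succ_self h g x : g x <= osc_succ h g x.
Proof. by apply: le_trans (usc_env_le_osc_succ h g x); exact: usc_env_ge. Qed.

(** The domination principle: a nonnegative function that is stable under one
   oscillation step bounds all the transfinite oscillations. *)
Lemma osc_le h g : (forall x, 0 <= g x) -> (forall x, osc_succ h g x <= g x) ->
  forall a x, osc h a x <= g x.
Proof.
move=> g0 gg; elim/(well_founded_ind lt_omega1_wf) => b IH x.
have Ug k : (forall y, k y <= g y) -> usc_env k x <= g x.
  move=> kg; apply: le_trans (le_limf_esup _ kg) _.
  exact: le_trans (usc_env_le_osc_succ h g x) (gg x).
have [b0|[a ab]|lb] := omega1_cases b.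
- by rewrite osc_zero//; exact: g0.
- rewrite (osc_succE _ ab); apply: Ug => y.
  apply: le_trans (le_osc_succ _ _ _) (gg y) => z.
  by apply: IH; exact: ab.1.
- rewrite osc_limitE//; apply: Ug => y.
  by apply: ge_ereal_sup => _ [a ab <-]; exact: IH.
Qed.

Lemma osc_succ_le_osc h a b x : is_succ a b ->
  osc_succ h (osc h a) x <= osc h b x.
Proof. by move=> ab; rewrite (osc_succE _ ab); exact: usc_env_ge. Qed.

Lemma osc_mono h a b x : (a <= b)%O -> osc h a x <= osc h b x.
Proof.
elim/(well_founded_ind lt_omega1_wf): b a => b IH a.
rewrite le_eqVlt => /predU1P[->//|ab].
have [b0|[c cb]|lb] := omega1_cases b.
- by move: ab; rewrite ltNge b0.
- apply: le_trans (osc_succ_le_osc h x cb).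
  apply: le_trans (le_osc_succ_self h _ x).
  apply: IH; first exact: cb.1.
  by rewrite leNgt; apply/negP => ca; apply: (cb.2 a); rewrite ca ab.
- rewrite (osc_limitE h lb); set g := (X in usc_env X).
  apply: (@le_trans _ _ (g x)); last exact: usc_env_ge.
  by apply: ereal_sup_ubound; exists a.
Qed.

Lemma osc_ge0 h a x : 0 <= osc h a x.
Proof.
have [z zmin] := omega1_zero.
by apply: le_trans (osc_mono h x (zmin a)); rewrite osc_zero// lexx.
Qed.

(** The supremum of all the oscillations over the countable ordinals. *)
Definition osc_sup h x := ereal_sup [set osc h a x | a in [set: omega1]].

Lemma osc_sup_ge h a x : osc h a x <= osc_sup h x.
Proof. by apply: ereal_sup_ubound; exists a. Qed.

Lemma osc_sup_ge0 h x : 0 <= osc_sup h x.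
Proof.
have [z _] := omega1_zero.
exact: le_trans (osc_ge0 h z x) (osc_sup_ge h z x).
Qed.

(** In a first countable space the supremum of the oscillations is stable
   under one more step, since countably many countable ordinals have a
   countable upper bound. *)
Lemma osc_succ_osc_sup h x (B : nat -> set X) :
  (forall n, nbhs x (B n)) ->
  (forall U, nbhs x U -> exists n, B n `<=` U) ->
  osc_succ h (osc_sup h) x <= osc_sup h x.
Proof.
move=> Bx Bbase; rewrite leNgt; apply/negP => lt.
have [c /andP[c1 c2]] : exists c, osc_sup h x < c < osc_succ h (osc_sup h) x.
  have := osc_sup_ge0 h x; move: lt.
  case: (osc_sup h x) => [r| |]//; case: (osc_succ _ _ _) => [t| |]//.
    rewrite lte_fin => rt _; exists ((r + t) / 2)%:E.
    by rewrite !lte_fin !midf_lt.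
  by move=> _ _; exists (r + 1)%:E; rewrite lte_fin ltrDl ltr01 ltry.
have H n : exists ya : X * omega1,
    B n ya.1 /\ c < `|h ya.1 - h x|%:E + osc h ya.2 ya.1.
  apply: contrapT => /forallNP nH.
  move: c2; rewrite ltNge => /negP; apply.
  apply: limf_esup_le; apply: filterS (Bx n) => y By.
  rewrite -leeBrDl//; apply: ge_ereal_sup => _ [a _ <-].
  rewrite leeBrDl// leNgt; apply/negP => ?; exact: (nH (y, a)).
have [ya yaP] := choice H.
have [a aub] := omega1_above (fun n => (ya n).2).
have [b ab] := omega1_succ a.
have : osc_succ h (osc h a) x < c.
  apply: le_lt_trans c1; apply: le_trans (osc_sup_ge h b x).
  exact: osc_succ_le_osc.
move=> /limf_esup_lt /Bbase [n]; move: (yaP n) => [By cy] /(_ _ By) /=.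
rewrite ltNge => /negP; apply; apply: le_trans (ltW cy) _.
by rewrite leeD2l//; apply: osc_mono; exact: ltW.
Qed.

End oscillations.

(** * Lower semicontinuity on a subset *)

Section lower_semicontinuity.
Context {R : realType} {X : topologicalType}.
Implicit Types (h s u v : X -> R) (A : set X) (x : X).

(** [lsc_on A u]: the restriction of [u] to the subspace [A] is lower
   semicontinuous. *)
Definition lsc_on A u := forall x, A x -> forall e : R, 0 < e ->
  \forall y \near x, A y -> u x - e < u y.

(** [lsc_split f A]: on the subspace [A], [f] is half the difference of the
   nonnegative lower semicontinuous functions [s + f] and [s - f]. *)
Definition lsc_split (f : X -> R) (A : set X) := exists s : X -> R,
  [/\ forall x, A x -> `|f x| <= s x,
      lsc_on A (fun x => s x + f x) & lsc_on A (fun x => s x - f x)].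

Lemma lsc_on_sub (A B : set X) (u : X -> R) :
  A `<=` B -> lsc_on B u -> lsc_on A u.
Proof.
move=> AB lu x /AB Bx e e0; apply: filterS (lu x Bx e e0) => y uy.
by move=> /AB; exact: uy.
Qed.

Lemma lsc_split_sub (f : X -> R) (A B : set X) :
  A `<=` B -> lsc_split f B -> lsc_split f A.
Proof.
move=> AB [s [fs l1 l2]]; exists s; split; last 2 first.
- exact: lsc_on_sub l1.
- exact: lsc_on_sub l2.
by move=> x /AB; exact: fs.
Qed.

Lemma lsc_on_avg A h s :
  lsc_on A (fun x => s x + h x) -> lsc_on A (fun x => s x - h x) -> lsc_on A s.
Proof.
move=> l1 l2 x Ax e e0.
near=> y => Ay.
have : s x + h x - e < s y + h y by move: Ay; near: y; exact: l1.
have : s x - h x - e < s y - h y by move: Ay; near: y; exact: l2.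
by lra.
Unshelve. all: by end_near. Qed.

Lemma nondecreasing_lim_lsc (u_ : nat -> X -> R) u :
  (forall n, continuous (u_ n)) ->
  (forall x n, u_ n x <= u_ n.+1 x) ->
  (forall x, u_ n x @[n --> \oo] --> u x) ->
  lsc_on setT u.
Proof.
move=> cu ndu uu x _ e e0.
have le_u n y : u_ n y <= u y.
  have nd : nondecreasing_seq (u_ ^~ y) by apply/nondecreasing_seqP => m.
  rewrite -(cvg_lim (@Rhausdorff R) (uu y)).
  by apply: nondecreasing_cvgn_le => //; apply/cvg_ex; exists (u y); exact: uu.
have : \forall n \near \oo, u x - e < u_ n x.
  by apply: (cvgr_gt _ (uu x)); rewrite ltrBlDr ltrDl.
move=> [n _ /(_ n (leqnn n)) xn].
near=> y => _; apply: lt_le_trans (le_u n y).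
by near: y; exact: (cvgr_gt _ (cu n x)).
Unshelve. all: by end_near. Qed.

(** A point [x0] of upper semicontinuity of [s], hence of continuity, is a
   strong continuity point of [h]: for every [e > 0] the function equal to
   [s x0 + e - s] near [x0] and to [+oo] elsewhere dominates the oscillations
   of [h]. *)
Lemma lsc_strong_continuity h s x0 :
  lsc_on setT (fun x => s x + h x) -> lsc_on setT (fun x => s x - h x) ->
  (forall e : R, 0 < e -> \forall y \near x0, s y < s x0 + e) ->
  strong_continuity_point h x0.
Proof.
move=> l1 l2 usc a; apply/eqP; rewrite eq_le osc_ge0 andbT.
apply/lee_addgt0Pr => e e0; rewrite add0e.
pose V : set X := [set y | s y < s x0 + e]°.
have Vx0 : V x0 by exact: usc.
pose g y : \bar R := if y \in V then (s x0 + e - s y)%:E else +oo%E.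
have gV y : V y -> g y = (s x0 + e - s y)%:E by move=> Vy; rewrite /g mem_set.
suff /(_ a x0) : forall a x, (osc h a x <= g x)%E.
  by rewrite gV// (_ : s x0 + e - s x0 = e)//; ring.
apply: osc_le => x.
  rewrite /g; case: ifPn => [|//]; rewrite inE => /interior_subset /= sx.
  by rewrite lee_fin subr_ge0 ltW.
have [Vx|nVx] := pselect (V x); last first.
  by rewrite /g memNset// leey.
rewrite gV//; apply/lee_addgt0Pr => r r0.
apply: limf_esup_le; near=> y.
have Vy : V y.
  by near: y; apply: open_nbhs_nbhs; split => //; exact: open_interior.
rewrite gV// -!EFinD lee_fin.
have s1 : s x + h x - r < s y + h y by apply: (near (l1 x I r r0) y).
have s2 : s x - h x - r < s y - h y by apply: (near (l2 x I r r0) y).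
have : `|h y - h x| <= s y - s x + r.
  by rewrite ler_norml; apply/andP; split; lra.
by lra.
Unshelve. all: by end_near. Qed.

(** The function [s] is the sum of the absolute values of the increments: the
   partial sums plus or minus [f_ n] form nondecreasing sequences of continuous
   functions. *)
Lemma DSC_lsc h : DSC h -> exists s,
  lsc_on setT (fun x => s x + h x) /\ lsc_on setT (fun x => s x - h x).
Proof.
move=> [f_ [cf fh sumf]].
pose S n x : R := \sum_(0 <= k < n) `|f_ k.+1 x - f_ k x|.
have SE n x : S n.+1 x = S n x + `|f_ n.+1 x - f_ n x|.
  by rewrite /S big_nat_recr.
have cS n : continuous (S n).
  elim: n => [|n IH] x.
    rewrite (_ : S 0%N = cst 0); first exact: cvg_cst.
    by apply/funext => y; rewrite /S big_geq.
  rewrite (_ : S n.+1 = (fun x => S n x + `|f_ n.+1 x - f_ n x|)); last first.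
    by apply/funext => y; rewrite SE.
  apply: cvgD; first exact: IH.
  by apply: cvg_norm; apply: cvgB; exact: cf.
have ndS x : nondecreasing_seq (S ^~ x).
  by apply/nondecreasing_seqP => n; rewrite SE lerDl.
have cvS x : cvgn (S ^~ x).
  apply: nondecreasing_is_cvgn => //.
  exists (fine (\sum_(0 <= n <oo) `|f_ n.+1 x - f_ n x|%:E)%E) => _ [n _ <-].
  rewrite -lee_fin fineK; last first.
    by rewrite ge0_fin_numE// nneseries_ge0// => *; rewrite lee_fin.
  rewrite /S -sumEFin; by apply: nneseries_lim_ge => *; rewrite lee_fin.
exists (fun x => limn (S ^~ x)); split.
- apply: (@nondecreasing_lim_lsc (fun n x => S n x + f_ n x)) => [n x|x n|x].
  + by apply: cvgD; [exact: cS|exact: cf].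
  + rewrite SE; have := ler_norm (f_ n x - f_ n.+1 x); rewrite distrC; lra.
  + by apply: cvgD; [exact: cvS|exact: fh].
- apply: (@nondecreasing_lim_lsc (fun n x => S n x - f_ n x)) => [n x|x n|x].
  + by apply: cvgB; [exact: cS|exact: cf].
  + rewrite SE; have := ler_norm (f_ n.+1 x - f_ n x); lra.
  + by apply: cvgB; [exact: cvS|exact: fh].
Qed.

End lower_semicontinuity.

Lemma ex_least (P : nat -> Prop) : (exists n, P n) ->
  exists n, P n /\ forall m, (m < n)%N -> ~ P m.
Proof.
move=> [n0 Pn0]; have ex : exists n, `[< P n >] by exists n0; exact/asboolP.
case: (ex_minnP ex) => n /asboolP Pn nmin; exists n; split => // m mn.
by move=> /asboolP /nmin; rewrite leqNgt mn.
Qed.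

Section metric_spaces.
Context {R : realType} {X : topologicalType} (d : X -> X -> R).
Hypotheses (dm : is_metric d) (dt : metrizes d).

Let d_ge0 x y : 0 <= d x y. Proof. by case: dm. Qed.
Let dxx x : d x x = 0.
Proof. by case: dm => _ + _ _; move=> /(_ x x)[_ ->]. Qed.
Let dC x y : d x y = d y x. Proof. by case: dm. Qed.
Let d_tri x y z : d x z <= d x y + d y z. Proof. by case: dm. Qed.

Lemma nbhs_metric_ball x (e : R) : 0 < e -> nbhs x [set y | d x y < e].
Proof. by move=> e0; apply/dt; exists e. Qed.

(** * Baire category in complete metric spaces *)

(** Baire's theorem, by nested balls with radii tending to [0], the closed
   ball number [n.+1] lying in the ball number [n] and in [O n]. *)
Lemma baire_category (O : nat -> set X) : complete_metric d ->
  (forall n, open (O n)) -> (forall n, dense (O n)) -> dense (\bigcap_n O n).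
Proof.
move=> dc oO dO W [w Ww] oW.
have step (np : nat * (X * R)) : exists q : X * R, 0 < np.2.2 ->
    [/\ 0 < q.2, q.2 <= np.1.+1%:R^-1 & forall y, d q.1 y <= q.2 ->
      d np.2.1 y < np.2.2 /\ O np.1 y].
  case: np => n [x r] /=; have [r0|] := ltP 0 r; last by exists (x, r).
  pose B : set X := [set y | d x y < r]°.
  have Bx : B x by exact: nbhs_metric_ball.
  have [|z [Bz Oz]] := dO n B _ (open_interior _); first by exists x.
  have : nbhs z (B `&` O n).
    by apply: filterI; apply: open_nbhs_nbhs; split => //; exact: open_interior.
  move=> /dt[e e0 eB].
  exists (z, Num.min (e / 2) n.+1%:R^-1) => _ /=; split.
  - by rewrite lt_min divr_gt0//= invr_gt0 ltr0n.
  - by rewrite ge_min lexx orbT.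
  - move=> y; rewrite le_min => /andP[ye _].
    have [|By Oy] := eB y; first by rewrite /=; lra.
    by split => //; exact: (interior_subset By).
have [g gP] := choice step.
have /dt[r0 r00 r0W] : nbhs w W by exact: open_nbhs_nbhs.
pose s := fix s n := if n is m.+1 then g (m, s m) else (w, r0).
have s0 n : 0 < (s n).2.
  by elim: n => //= n IH; have [] := gP (n, s n) IH.
have sle n : (s n.+1).2 <= n.+1%:R^-1 by have [] := gP (n, s n) (s0 n).
have sin n y : d (s n.+1).1 y <= (s n.+1).2 -> d (s n).1 y < (s n).2 /\ O n y.
  by have [_ _] := gP (n, s n) (s0 n); exact.
have nest n k y :
  d (s (n + k)%N).1 y < (s (n + k)%N).2 -> d (s n).1 y < (s n).2.
  elim: k => [|k IH]; first by rewrite addn0.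
  by rewrite addnS => /ltW /sin[/IH].
have near_s n m : (n <= m)%N -> d (s n).1 (s m).1 < (s n).2.
  by move=> nm; apply: (nest n (m - n)%N); rewrite subnKC// dxx.
have [e e0|x sx] := dc (fun n => (s n).1).
  have [n ne] : exists n : nat, n.+1%:R^-1 < e / 2 :> R.
    exists (Num.truncn (e / 2)^-1).
    by rewrite invf_plt ?posrE ?divr_gt0// truncnS_gt.
  exists n.+1 => m k nm nk.
  have := near_s _ _ nm; have := near_s _ _ nk; have := sle n.
  have := d_tri (s m).1 (s n.+1).1 (s k).1; rewrite (dC (s m).1 (s n.+1).1).
  by move: n.+1%:R^-1 ne => c; lra.
have xs n : d (s n).1 x <= (s n).2.
  apply/ler_addgt0Pr => e e0.
  have [N _ NP] := sx _ (nbhs_metric_ball x e0).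
  have /= := NP (maxn n N) (leq_maxr _ _).
  have := near_s n (maxn n N) (leq_maxl _ _).
  have := d_tri (s n).1 (s (maxn n N)).1 x; rewrite (dC (s (maxn n N)).1 x).
  by lra.
exists x; split; first by apply: r0W; have [] := sin 0%N _ (xs 1%N).
by move=> n _; have [] := sin n _ (xs n.+1).
Qed.

(** A point where [s] is not upper semicontinuous lies on the boundary of
   a closed set [s <= q] for some rational [q], and such boundaries are nowhere
   dense. *)
Lemma lsc_residual_continuity (s : X -> R) : complete_metric d ->
  lsc_on setT s -> exists G, [/\ Gdelta G, dense G &
    forall x, G x -> forall e : R, 0 < e -> \forall y \near x, s y < s x + e].
Proof.
move=> dc ls.
pose q n : R := ratr (odflt 0 (unpickle n)).
pose F n : set X := [set x | s x <= q n].
pose O n : set X := (F n)° `|` ~` F n.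
have oO n : open (O n).
  apply: openU; first exact: open_interior.
  rewrite openE => x /= /negP; rewrite -ltNge => qs.
  have : 0 < s x - q n by rewrite subr_gt0.
  move=> /(ls x I); apply: filterS => y /(_ I).
  by rewrite subKr => ?; apply/negP; rewrite -ltNge.
exists (\bigcap_n O n); split.
- by exists O.
- apply: baire_category => // n W [w Ww] oW.
  have [WF|/existsNP[z /not_implyP[Wz nFz]]] := pselect (W `<=` F n).
    exists w; split => //; left.
    by apply: filterS WF _; exact: open_nbhs_nbhs.
  by exists z; split => //; right.
- move=> x Gx e e0.
  have [|t] := @rat_in_itvoo R (s x) (s x + e); first by rewrite ltrDl.
  rewrite in_itv /= => /andP[xt te].
  have qt : q (pickle t) = ratr t by rewrite /q pickleK.
  have [|] := Gx (pickle t) I; last by rewrite /F /= qt (ltW xt).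
  by apply: filterS => y; rewrite /F /= qt => yt; exact: le_lt_trans te.
Qed.

Lemma DSC_residual (h : X -> R) : complete_metric d -> DSC h ->
  exists G, [/\ Gdelta G, dense G &
    G `<=` [set x | strong_continuity_point h x]].
Proof.
move=> dc /DSC_lsc[s [l1 l2]].
have [G [Gd dG Gs]] := lsc_residual_continuity dc (lsc_on_avg l1 l2).
by exists G; split => // x /Gs; exact: lsc_strong_continuity.
Qed.

(** * Approximation of semicontinuous functions on metric spaces *)

(** For a nonnegative [p], the largest [n]-Lipschitz minorant of [p]. *)
Definition lip_reg (p : X -> R) (n : nat) (x : X) : R :=
  inf [set p y + n%:R * d x y | y in [set: X]].

Section nonnegative.
Variable p : X -> R.
Hypothesis p0 : forall x, 0 <= p x.

Lemma lip_reg_le n x y : lip_reg p n x <= p y + n%:R * d x y.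
Proof.
apply: ge_inf; last by exists y.
by exists 0 => _ [z _ <-]; rewrite addr_ge0// mulr_ge0.
Qed.

Lemma lip_reg_ge n x c :
  (forall y, c <= p y + n%:R * d x y) -> c <= lip_reg p n x.
Proof.
move=> cp; apply: lb_le_inf; first by exists (p x + n%:R * d x x), x.
by move=> _ [y _ <-].
Qed.

Lemma lip_reg_ge0 n x : 0 <= lip_reg p n x.
Proof. by apply: lip_reg_ge => y; rewrite addr_ge0// mulr_ge0. Qed.

Lemma lip_reg_le_id n x : lip_reg p n x <= p x.
Proof. by have := lip_reg_le n x x; rewrite dxx mulr0 addr0. Qed.

Lemma lip_reg_lipschitz n x y : lip_reg p n x <= lip_reg p n y + n%:R * d x y.
Proof.
rewrite -lerBlDr; apply: lip_reg_ge => z; rewrite lerBlDr.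
apply: le_trans (lip_reg_le n x z) _; rewrite -addrA lerD2l -mulrDr.
by rewrite ler_wpM2l// addrC.
Qed.

Lemma lip_reg_continuous n : continuous (lip_reg p n).
Proof.
move=> x; apply/cvgrPdist_lt => e e0.
have n0 : 0 < n.+1%:R :> R by rewrite ltr0n.
apply: filterS (nbhs_metric_ball x (divr_gt0 e0 n0)) => y /= xy.
have l : n%:R * d x y < e.
  apply: le_lt_trans (_ : n.+1%:R * d x y < e).
    by rewrite ler_wpM2r// ler_nat.
  by rewrite mulrC -ltr_pdivlMr.
have := lip_reg_lipschitz n x y; have := lip_reg_lipschitz n y x.
rewrite (dC y x) ltr_norml => h1 h2; apply/andP; split; lra.
Qed.

Lemma lip_reg_nd n x : lip_reg p n x <= lip_reg p n.+1 x.
Proof.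
apply: lip_reg_ge => y; apply: le_trans (lip_reg_le n x y) _.
by rewrite lerD2l ler_wpM2r// ler_nat.
Qed.

Lemma lip_reg_cvg x : lsc_on setT p -> lip_reg p n x @[n --> \oo] --> p x.
Proof.
move=> lp; apply/cvgrPdist_le => e e0.
have /dt[r r0 rp] := lp x I e e0.
near=> n.
have np : p x / r <= n%:R by near: n; exact: nbhs_infty_ger.
have := lip_reg_le_id n x.
suff : p x - e <= lip_reg p n x.
  by move=> h1 h2; rewrite ler_norml; apply/andP; split; lra.
apply: lip_reg_ge => y.
have [/rp/(_ I) ?|ry] := ltP (d x y) r.
  by apply: ltW; apply: ltr_wpDr => //; rewrite mulr_ge0.
have : p x <= n%:R * d x y.
  apply: (@le_trans _ _ (n%:R * r)); first by rewrite -ler_pdivrMr.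
  by rewrite ler_wpM2l.
have := p0 y; lra.
Unshelve. all: by end_near. Qed.

End nonnegative.

(** A function [f] is the difference of [(s + f) / 2] and [(s - f) / 2]. *)
Lemma lsc_DSC (f s : X -> R) : (forall x, `|f x| <= s x) ->
  lsc_on setT (fun x => s x + f x) -> lsc_on setT (fun x => s x - f x) -> DSC f.
Proof.
move=> fs l1 l2.
pose p x := s x + f x; pose q x := s x - f x.
have p0 x : 0 <= p x by have := fs x; rewrite /p ler_norml => /andP[]; lra.
have q0 x : 0 <= q x by have := fs x; rewrite /q ler_norml => /andP[]; lra.
exists (fun n x => (lip_reg p n x - lip_reg q n x) / 2); split.
- move=> n x; apply: cvgMr_tmp; apply: cvgB; exact: lip_reg_continuous.
- move=> x; have -> : f x = (p x - q x) / 2 by rewrite /p /q; lra.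
  by apply: cvgMr_tmp; apply: cvgB; exact: lip_reg_cvg.
- move=> x; apply: (@le_lt_trans _ _ (s x)%:E); last exact: ltry.
  apply: lime_le; first by apply: is_cvg_nneseries => *; rewrite lee_fin.
  apply: nearW => n; rewrite sumEFin lee_fin.
  apply: (@le_trans _ _ ((lip_reg p n x + lip_reg q n x) / 2)); last first.
    have := lip_reg_le_id p0 n x; have := lip_reg_le_id q0 n x.
    by rewrite /p /q; lra.
  elim: n => [|n IH].
    by rewrite big_geq// divr_ge0// addr_ge0// lip_reg_ge0.
  rewrite big_nat_recr//=.
  suff : `|(lip_reg p n.+1 x - lip_reg q n.+1 x) / 2 -
            (lip_reg p n x - lip_reg q n x) / 2| <=
      (lip_reg p n.+1 x + lip_reg q n.+1 x) / 2 -
      (lip_reg p n x + lip_reg q n x) / 2 by move: IH; lra.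
  have := lip_reg_nd p0 n x; have := lip_reg_nd q0 n x.
  by move=> *; rewrite ler_norml; apply/andP; split; lra.
Qed.

(** * Gluing along countable closed covers *)

(** Let the level [idx x] be the first [n] with [F n x], and [phi x] the least
   [k] such that no point within [k.+1^-1] of [x] has a lower level.  The glued
   function is [s_ (idx x) x + phi x]: levels do not drop near a point, [phi]
   is lower semicontinuous along each level, and it tends to infinity when
   a point is approached along higher levels. *)
Lemma lsc_split_closed_cover (f : X -> R) (F : nat -> set X) :
  (forall n, closed (F n)) -> (forall n, lsc_split f (F n)) ->
  (forall x, exists n, F n x) -> lsc_split f setT.
Proof.
move=> cF spF covF; have [s_ sP] := choice spF.
have [idx idxP] := choice (fun x => ex_least (covF x)).
have idx_lsc x : \forall y \near x, (idx x <= idx y)%N.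
  suff H n : (n <= idx x)%N -> \forall y \near x, (n <= idx y)%N by exact: H.
  elim: n => [_|n IH nx]; first exact: nearW.
  apply: filterS2 (IH (ltnW nx)) (_ : \forall y \near x, ~ F n y).
    move=> y ny nFy; rewrite ltn_neqAle ny andbT; apply/eqP => nE.
    by apply: nFy; rewrite nE; have [] := idxP y.
  have : open (~` F n) by exact: closed_openC.
  by rewrite openE; apply; have [_] := idxP x; exact.
pose far x (k : nat) :=
  forall z, d x z < k.+1%:R^-1 -> (idx x <= idx z)%N.
have ex_far x : exists k, far x k.
  have /dt[e e0 eP] := idx_lsc x.
  exists (Num.truncn e^-1) => z xz; apply: eP => /=; apply: lt_trans xz _.
  by rewrite invf_plt ?posrE// truncnS_gt.
have [phi phiP] := choice (fun x => ex_least (ex_far x)).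
(* [phi] is large at the points close to a lower level. *)
have phi_ge x (k : nat) z :
    d x z < k.+1%:R^-1 -> (idx z < idx x)%N -> (k < phi x)%N.
  move=> xz zx; rewrite ltnNge; apply/negP => pk.
  have := (phiP x).1 z; rewrite leqNgt zx => /(_ _)/negP; apply; last by [].
  by apply: lt_le_trans xz _; rewrite lef_pV2 ?posrE// ler_nat.
have phi_lsc x : \forall y \near x, idx y = idx x -> (phi x <= phi y)%N.
  case px : (phi x) => [|k]; first exact: nearW.
  have kp : (k < phi x)%N by rewrite px.
  have /existsNP[z /not_implyP[xz /negP]] := (phiP x).2 k kp.
  rewrite -ltnNge => zx.
  have e0 : 0 < k.+1%:R^-1 - d x z by rewrite subr_gt0.
  apply: filterS (nbhs_metric_ball x e0) => y /= xy yx.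
  apply: (phi_ge y k z); last by rewrite yx.
  by have := d_tri y x z; rewrite (dC y x); move: k.+1%:R^-1 xy => c; lra.
pose s x := s_ (idx x) x + (phi x)%:R.
have glue (g : X -> R) : (forall n x, F n x -> 0 <= s_ n x + g x) ->
    (forall n, lsc_on (F n) (fun x => s_ n x + g x)) ->
    lsc_on setT (fun x => s x + g x).
  move=> g0 lg x _ e e0.
  pose m := Num.truncn (s x + g x).
  have m0 : 0 < m.+1%:R^-1 :> R by rewrite invr_gt0 ltr0n.
  near=> y => _.
  have : (idx x <= idx y)%N by near: y; exact: idx_lsc.
  rewrite leq_eqVlt => /orP[/eqP xy|xy].
    have py : (phi x <= phi y)%N by apply: (near (phi_lsc x) y).
    have : s_ (idx x) x + g x - e < s_ (idx x) y + g y.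
      apply: (near (lg (idx x) x (idxP x).1 e e0) y) => //.
      by rewrite xy; have [] := idxP y.
    have : (phi x)%:R <= (phi y)%:R :> R by rewrite ler_nat.
    by rewrite /s -xy; lra.
  have dxy : d x y < m.+1%:R^-1.
    by apply: (near (nbhs_metric_ball x m0) y).
  have my : (m.+1 <= phi y)%N by apply: (phi_ge y m x); rewrite // dC.
  have : m.+1%:R <= (phi y)%:R :> R by rewrite ler_nat.
  have : s x + g x < m.+1%:R by rewrite truncnS_gt.
  have := g0 (idx y) y (idxP y).1; rewrite [s y]/s.
  by move: m.+1%:R => c; lra.
exists s; split.
- move=> x _; have [/(_ x (idxP x).1) + _ _] := sP (idx x).
  by move=> /le_trans; apply; rewrite /s lerDl.
- apply: glue => n; last by have [] := sP n.
  move=> x Fx; have [/(_ x Fx) + _ _] := sP n.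
  by rewrite ler_norml => /andP[]; lra.
- apply: (glue (fun x => - f x)) => n; last by have [] := sP n.
  move=> x Fx; have [/(_ x Fx) + _ _] := sP n.
  by rewrite ler_norml => /andP[]; lra.
Unshelve. all: by end_near. Qed.

Lemma closed_metric_ball x r : closed [set y | d x y <= r].
Proof.
rewrite -openC openE => y /= /negP; rewrite -ltNge => ry.
have e0 : 0 < d x y - r by rewrite subr_gt0.
apply: filterS (nbhs_metric_ball y e0) => z /= yz.
by apply/negP; rewrite -ltNge; have := d_tri x z y; rewrite (dC z y); lra.
Qed.

(** Let [U] be the union of the basic balls that are covered by countably many
   closed sets on which [f] splits.  Were the complement of [U] nonempty,
   a basic ball around one of its points would again be covered. *)
Lemma lsc_split_exhaustion (D : set X) (f : X -> R) : countable D -> dense D ->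
  (forall L, closed L -> L !=set0 -> exists2 x, L x &
    exists2 V, nbhs x V & lsc_split f (L `&` V)) ->
  lsc_split f setT.
Proof.
move=> cD dD loc.
pose ball (p : X * nat) : set X := [set y | d p.1 y < p.2.+1%:R^-1].
pose covers (Fam : set (set X)) (B : set X) := [/\ countable Fam,
  forall A, Fam A -> closed A /\ lsc_split f A &
  forall y, B y -> exists2 A, Fam A & A y].
have ex_Fam p : exists Fam',
    (exists Fam, covers Fam (ball p)) -> covers Fam' (ball p).
  have [[Fam ?]|n] := pselect (exists Fam, covers Fam (ball p)).
    by exists Fam.
  by exists set0.
have [Fam_ FamP] := choice ex_Fam.
pose J : set (X * nat) := [set p | D p.1 /\ exists Fam, covers Fam (ball p)].
pose Fam := \bigcup_(p in J) Fam_ p.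
have cFam : countable Fam.
  apply: bigcup_countable => [|p [_ /FamP[]//]].
  apply: (@sub_countable _ _ _ (D `*` [set: nat])).
    by apply: subset_card_le => p [].
  exact: countableX.
have gFam A : Fam A -> closed A /\ lsc_split f A.
  by move=> [p [_ /FamP[_ + _]]]; exact.
pose U := \bigcup_(p in J) ball p.
have oU : open U.
  apply: bigcup_open => p _; rewrite openE => y /= py.
  have e0 : 0 < p.2.+1%:R^-1 - d p.1 y by rewrite subr_gt0.
  apply: filterS (nbhs_metric_ball y e0) => z /= yz.
  by rewrite /ball /=; have := d_tri p.1 y z; move: p.2.+1%:R^-1 yz => c; lra.
have UFam y : U y -> exists2 A, Fam A & A y.
  move=> [p pJ py]; have [_ /FamP[_ _ /(_ y py)[A pA Ay]]] := pJ.
  by exists A => //; exists p.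
have UT y : U y.
  apply: contrapT => nUy.
  have [|x nUx [V /dt[e e0 eV] Vs]] := loc (~` U) (open_closedC oU).
    by exists y.
  pose n := Num.truncn (e / 2)^-1.
  have ne : n.+1%:R^-1 < e / 2 :> R.
    by rewrite invf_plt ?posrE ?divr_gt0// truncnS_gt.
  have n0 : 0 < n.+1%:R^-1 :> R by rewrite invr_gt0 ltr0n.
  have [|a [/interior_subset /= xa Da]] :=
      dD [set z | d x z < n.+1%:R^-1]° _ (open_interior _).
    by exists x; exact: nbhs_metric_ball.
  apply: nUx; exists (a, n); last by rewrite /ball /= dC.
  split => //.
  exists (Fam `|` [set ~` U `&` [set z | d a z <= n.+1%:R^-1]]); split.
  - rewrite -bigcup2E; apply: bigcup_countable => // -[|[|k]] _ //=.
  - move=> A [/gFam//|->]; split.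
      by apply: closedI; [exact: open_closedC|exact: closed_metric_ball].
    apply: lsc_split_sub Vs => z [nUz /= az]; split => //; apply: eV => /=.
    by have := d_tri x a z; move: n.+1%:R^-1 ne xa az => c; lra.
  - move=> z az; have [/UFam[A FA Az]|nUz] := pselect (U z).
      by exists A => //; left.
    exists (~` U `&` [set z | d a z <= n.+1%:R^-1]); first by right.
      by split => //; exact: ltW.
(* The countable family is now indexed by [nat], with [set0] for the numbers
   that are not used. *)
have /countable_injP[num inj] := cFam.
pose F n := [set y | exists A, [/\ Fam A, num A = n & A y]].
have FE n : F n = set0 \/ Fam (F n).
  have [[A [FA An]]|nA] := pselect (exists A, Fam A /\ num A = n); last first.
    left; apply/seteqP; split => // y [A [FA An _]].
    by apply: nA; exists A.
  right; suff -> : F n = A by [].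
  apply/seteqP; split => [y [B [FB Bn By]]|y Ay]; last by exists A.
  by rewrite (inj A B) ?inE// An.
apply: (@lsc_split_closed_cover _ F) => [n|n|x].
- by have [->|/gFam[]//] := FE n; exact: closed0.
- have [->|/gFam[]//] := FE n.
  by exists (cst 0); split => x [].
- by have [A FA Ax] := UFam x (UT x); exists (num A), A.
Qed.

End metric_spaces.

(** * Closed subspaces *)

Section closed_subspace.
Context {R : realType} {K : topologicalType} (d : K -> K -> R).
Hypotheses (dm : is_metric d) (dt : metrizes d).
Variable L : set K.

(** The metric of the subspace [L]. *)
Definition sub_metric (x y : L) : R := d (set_val x) (set_val y).

Lemma set_val_inj : injective (set_val : L -> K).
Proof. exact: val_inj. Qed.

Lemma set_val_mem (x : L) : L (set_val x).
Proof. exact: set_mem (valP x). Qed.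

Lemma sub_metric_is_metric : is_metric sub_metric.
Proof.
case: dm => d0 deq dC dtri; split => [x y|x y|x y|x y z].
- exact: d0.
- by rewrite deq; split => [/set_val_inj|->].
- exact: dC.
- exact: dtri.
Qed.

Lemma sub_metric_metrizes : metrizes sub_metric.
Proof.
move=> x U; split.
  rewrite nbhsE => -[W [[V oV <-] /= Vx] WU].
  have /dt[e e0 eV] : nbhs (set_val x) V by exact: open_nbhs_nbhs.
  by exists e => // y /= xy; apply: WU; exact: eV.
move=> [e e0 eU].
have : nbhs (set_val x) [set y | d (set_val x) y < e].
  exact: (nbhs_metric_ball dt).
have cv : continuous (set_val : L -> K) by exact: initial_continuous.
by move=> /(cv x) nV; apply: (@filterS _ (nbhs x) _ _ _ _ nV) => y; exact: eU.
Qed.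

Lemma sub_metric_complete : closed L -> complete_metric d ->
  complete_metric sub_metric.
Proof.
move=> cL dc u /dc[x ux].
have Lx : L x.
  apply: (closed_cvg _ cL _ _ ux); apply: nearW => n; exact: set_val_mem.
exists (SigSub (mem_set Lx)) => U /sub_metric_metrizes[e e0 eU].
have [N _ NP] := ux _ (nbhs_metric_ball dt x e0).
by exists N => // n Nn; apply: eU; exact: NP.
Qed.

Lemma DSC_sigL (f : K -> R) : DSC f -> DSC (sigL L f).
Proof.
move=> [f_ [cf ff sf]]; exists (fun n => sigL L (f_ n)); split => [n|k|k].
- move=> x; apply: continuous_comp; first exact: initial_continuous.
  exact: cf.
- exact: ff.
- exact: sf.
Qed.

(** Near a point where the supremum [g] of the oscillations of the restriction
   of [f] to [L] is finite, [f] splits on [L] by means of [s = c - g] for a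
   large constant [c]. *)
Lemma osc_sup_lsc_split (f : K -> R) (x : L) :
  (osc_sup (sigL L f) x < +oo)%E ->
  exists2 V, nbhs (set_val x) V & lsc_split f (L `&` V).
Proof.
set h := sigL L f; set g := osc_sup h => gx.
have g0 y : (0 <= g y)%E by exact: osc_sup_ge0.
have gstep y : (osc_succ h g y <= g y)%E.
  apply: (@osc_succ_osc_sup _ _ h y
      (fun n => [set z | sub_metric y z < n.+1%:R^-1])) => [n|U].
    by apply: (nbhs_metric_ball sub_metric_metrizes); rewrite invr_gt0 ltr0n.
  move=> /sub_metric_metrizes[e e0 eU].
  exists (Num.truncn e^-1) => z /= yz; apply: eU => /=; apply: lt_trans yz _.
  by rewrite invf_plt ?posrE// truncnS_gt.
(* [g] is known to be finite only near [x]; [G] is [fine (g y)] on [L] and an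
   irrelevant [0] elsewhere. *)
have [G GE] : exists G : K -> R, forall y : L, G (set_val y) = fine (g y).
  exists (fun k => if pselect (L k) is left Lk
    then fine (g (SigSub (mem_set Lk))) else 0) => y.
  case: pselect => [Ly|]; last by have := set_val_mem y.
  by congr (fine (g _)); apply: set_val_inj.
pose C := fine (g x) + 1.
have /limf_esup_lt/sub_metric_metrizes[r r0 rP] : (osc_succ h g x < C%:E)%E.
  apply: (le_lt_trans (gstep x)).
  by rewrite -[g x]fineK ?ge0_fin_numE// lte_fin ltrDl.
exists [set y | d (set_val x) y < r]; first exact: (nbhs_metric_ball dt).
have gfin y : d (set_val x) (set_val y) < r -> g y \is a fin_num.
  move=> /rP /=; rewrite ge0_fin_numE// => /ltW gC.
  apply: (@le_lt_trans _ _ C%:E); last exact: ltry.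
  by apply: le_trans gC; rewrite leeDr// lee_fin.
have bound (y : L) : d (set_val x) (set_val y) < r ->
    `|f (set_val y) - f (set_val x)| + G (set_val y) < C.
  by move=> xy; rewrite -lte_fin EFinD GE fineK ?gfin//; exact: rP.
have osc1 (y : L) (e : R) : d (set_val x) (set_val y) < r -> 0 < e ->
    \forall z \near set_val y, L z -> d (set_val x) z < r ->
      `|f z - f (set_val y)| + G z < G (set_val y) + e.
  move=> xy e0.
  have : (osc_succ h g y < (G (set_val y) + e)%:E)%E.
    apply: (le_lt_trans (gstep y)).
    by rewrite -[g y]fineK ?gfin// -GE lte_fin ltrDl.
  move=> /limf_esup_lt/sub_metric_metrizes[t t0 tP].
  apply: filterS (nbhs_metric_ball dt (set_val y) t0) => z /= yz Lz xz.
  have := tP (SigSub (mem_set Lz)) yz.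
  rewrite /= -[g _]fineK; last exact: gfin.
  by rewrite -GE -EFinD lte_fin.
exists (fun y => C + `|f (set_val x)| - G y); split.
- move=> y [Ly /= xy]; have := bound (SigSub (mem_set Ly)) xy.
  rewrite !set_valE /= => b1.
  have := ler_normD (f y - f (set_val x)) (f (set_val x)); rewrite subrK.
  by move: b1; rewrite set_valE /=; lra.
- move=> y [Ly /= xy] e e0; have := osc1 (SigSub (mem_set Ly)) e xy e0.
  rewrite !set_valE /=; apply: filterS => z zP [/zP + xz] => /(_ xz).
  by have := ler_norm (f y - f z); rewrite distrC; lra.
- move=> y [Ly /= xy] e e0; have := osc1 (SigSub (mem_set Ly)) e xy e0.
  rewrite !set_valE /=; apply: filterS => z zP [/zP + xz] => /(_ xz).
  by have := ler_norm (f z - f y); lra.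
Qed.

End closed_subspace.

Theorem theorem5p1 (R : realType) (K : topologicalType)
    (HK : polish_space R K) (f : K -> R) :
  [<-> DSC f;
       forall L : set K, closed L -> L !=set0 ->
         exists x : L, strong_continuity_point (sigL L f) x;
       forall L : set K, closed L -> L !=set0 ->
         exists G : set L, [/\ Gdelta G, dense G &
           G `<=` [set x | strong_continuity_point (sigL L f) x]];
       forall L : set K, closed L -> L !=set0 ->
         exists x : L,
           (ereal_sup [set osc (sigL L f) a x | a in [set: omega1]] < +oo)%E ].
Proof.
have [[D cD dD] [d [dm dt dc]]] := HK.
have residual : DSC f -> forall L : set K, closed L -> L !=set0 ->
    exists G : set L, [/\ Gdelta G, dense G &
      G `<=` [set x | strong_continuity_point (sigL L f) x]].
  move=> Df L cL _.
  exact: (DSC_residual (sub_metric_is_metric dm L)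
    (sub_metric_metrizes dt (L := L)) (sub_metric_complete dt cL dc)
    (DSC_sigL L Df)).
have point : (forall L : set K, closed L -> L !=set0 ->
      exists G : set L, [/\ Gdelta G, dense G &
        G `<=` [set x | strong_continuity_point (sigL L f) x]]) ->
    forall L : set K, closed L -> L !=set0 ->
      exists x : L, strong_continuity_point (sigL L f) x.
  move=> H L cL L0; have [G [_ dG GS]] := H L cL L0; have [y Ly] := L0.
  have [|x [_ Gx]] := dG setT _ openT; first by exists (SigSub (mem_set Ly)).
  by exists x; exact: GS.
have bounded : (forall L : set K, closed L -> L !=set0 ->
      exists x : L, strong_continuity_point (sigL L f) x) ->
    forall L : set K, closed L -> L !=set0 ->
      exists x : L, (osc_sup (sigL L f) x < +oo)%E.
  move=> H L cL L0; have [x xP] := H L cL L0; exists x.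
  apply: le_lt_trans (ltry 0); apply: ge_ereal_sup => _ [a _ <-].
  by rewrite xP.
have split_DSC : (forall L : set K, closed L -> L !=set0 ->
      exists x : L, (osc_sup (sigL L f) x < +oo)%E) -> DSC f.
  move=> H; have [|s [fs l1 l2]] := lsc_split_exhaustion dm dt (f := f) cD dD.
    move=> L cL L0; have [x xfin] := H L cL L0; exists (set_val x).
      exact: set_val_mem.
    exact: (osc_sup_lsc_split dt).
  by apply: (lsc_DSC dm dt) l1 l2 => x; exact: fs.
tfae.
- by move=> /residual/point.
- by move=> /bounded/split_DSC/residual.
- by move=> /point/bounded.
- exact: split_DSC.
Qed.
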